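(* Let $\Gamma$ be a finite connected graph and let $\lambda_1,\ldots,\lambda_k$ be loxodromic elements of $A(\Gamma)$ with the property that for $i\neq j$, $\lambda_i$ and $\lambda_j$ share no common nonzero power. Then for all sufficiently large $N$ we have $\langle \lambda_1^N,\ldots,\lambda_k^N\rangle\cong F_k$, the free group of rank $k$.
   Context: Graphs are simplicial. $A(\Gamma)=\langle V(\Gamma)\mid [a,b]=1 \text{ for each } \{a,b\}\in E(\Gamma)\rangle$. The extension graph $\Gamma^e$ has vertex set $\{v^g : v\in V(\Gamma), g\in A(\Gamma)\}$, $v^g=g^{-1}vg$, with two distinct vertices adjacent iff they commute in $A(\Gamma)$; it carries the graph metric $d$, and $A(\Gamma)$ acts by conjugation $v^h\mapsto v^{hg}$. An element $g\in A(\Gamma)$ is loxodromic if $\lim_{n\to\infty}\frac1n d(x,x^{g^n})>0$ for $x\in\Gamma^e$. ''Share no common nonzero power'' means $\lambda_i^m\ne\lambda_j^n$ for all nonzero integers $m,n$. *)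

(* Defs.v *)
From HB Require Import structures.
From mathcomp Require Import all_boot all_order all_algebra.
From mathcomp Require Import boolp classical_sets reals topology normedtype.
From mathcomp Require Import sequences.
Import numFieldNormedType.Exports.

Set Implicit Arguments.
Unset Strict Implicit.
Unset Printing Implicit Defensive.

Local Open Scope classical_set_scope.
Local Open Scope quotient_scope.

(* The letter (s, true) stands for s and (s, false) for s^-1. *)
Definition word (S : Type) := seq (S * bool).

Definition inv_word (S : Type) (w : word S) : word S :=
  rev [seq (l.1, ~~ l.2) | l <- w].

Lemma inv_word_cat (S : Type) (u v : word S) :
  inv_word (u ++ v) = inv_word v ++ inv_word u.
Proof. by rewrite /inv_word map_cat rev_cat. Qed.

Lemma inv_wordK (S : Type) : involutive (@inv_word S).
Proof.
move=> w; rewrite /inv_word map_rev revK -map_comp -[RHS]map_id.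
by apply: eq_map => -[s b] /=; rewrite negbK.
Qed.

Inductive word_congr (S : Type) (rels : word S -> Prop) :
    word S -> word S -> Prop :=
| word_congr_refl w : word_congr rels w w
| word_congr_sym u v : word_congr rels u v -> word_congr rels v u
| word_congr_trans v u w :
    word_congr rels u v -> word_congr rels v w -> word_congr rels u w
| word_congr_cat u u' v v' :
    word_congr rels u u' -> word_congr rels v v' ->
    word_congr rels (u ++ v) (u' ++ v')
| word_congr_cancel s b : word_congr rels [:: (s, b); (s, ~~ b)] [::]
| word_congr_rel r : rels r -> word_congr rels r [::].

Lemma word_congr_mulV (S : Type) (rels : word S -> Prop) (w : word S) :
  word_congr rels (inv_word w ++ w) [::].
Proof.
elim: w => [|[s b] w IHw]; first exact: word_congr_refl.
rewrite -cat1s inv_word_cat -catA (catA _ [:: (s, b)]).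
apply: word_congr_trans IHw; apply: word_congr_cat.
  exact: word_congr_refl.
rewrite -[X in word_congr _ _ X]cat0s; apply: word_congr_cat.
  by have := word_congr_cancel rels s (~~ b); rewrite negbK.
exact: word_congr_refl.
Qed.

Lemma inv_word_congr (S : Type) (rels : word S -> Prop) (u v : word S) :
  word_congr rels u v -> word_congr rels (inv_word u) (inv_word v).
Proof.
elim=> {u v} [w|u v _|v u w _ IH1 _|u u' v v' _ IH1 _ IH2|s b|r rr].
- exact: word_congr_refl.
- exact: word_congr_sym.
- exact: word_congr_trans.
- by rewrite !inv_word_cat; apply: word_congr_cat.
- by rewrite /inv_word /rev /= negbK; apply: word_congr_cancel.
- apply: word_congr_trans (word_congr_mulV rels r).
  rewrite -[X in word_congr _ X _]cats0; apply: word_congr_cat.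
    exact: word_congr_refl.
  exact/word_congr_sym/word_congr_rel.
Qed.

Section PresentedGroup.
Variables (S : choiceType) (rels : word S -> Prop).

Let wrel : rel (seq (S * bool)) := fun u v => `[< word_congr rels u v >].

Let wrel_refl : reflexive wrel.
Proof. by move=> w; apply/asboolP; apply: word_congr_refl. Qed.

Let wrel_sym : symmetric wrel.
Proof.
by move=> u v; apply/asboolP/asboolP; apply: word_congr_sym.
Qed.

Let wrel_trans : transitive wrel.
Proof.
move=> v u w /asboolP uv /asboolP vw; apply/asboolP.
exact: word_congr_trans uv vw.
Qed.

Definition word_equiv : equiv_rel (seq (S * bool)) :=
  EquivRel wrel wrel_refl wrel_sym wrel_trans.

Definition presented := {eq_quot word_equiv}.

HB.instance Definition _ := Choice.on presented.

Definition word_class (w : word S) : presented := \pi_presented w.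

Lemma word_classP u v : word_class u = word_class v <-> word_congr rels u v.
Proof.
split=> [/eqmodP/asboolP //|uv]; apply/eqmodP/asboolP; exact: uv.
Qed.

Definition presented_one : presented := word_class [::].
Definition presented_mul (x y : presented) : presented :=
  word_class (repr x ++ repr y).
Definition presented_inv (x : presented) : presented :=
  word_class (inv_word (repr x)).

Let repr_class w : word_congr rels (repr (word_class w)) w.
Proof. by apply/word_classP; rewrite /word_class reprK. Qed.

Lemma presented_mulE u v :
  presented_mul (word_class u) (word_class v) = word_class (u ++ v).
Proof. by apply/word_classP/word_congr_cat; apply: repr_class. Qed.

Lemma presented_invE u :
  presented_inv (word_class u) = word_class (inv_word u).
Proof. by apply/word_classP/inv_word_congr/repr_class. Qed.

Let classP (x : presented) : exists w, x = word_class w.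
Proof. by exists (repr x); rewrite /word_class reprK. Qed.

Let mulA : associative presented_mul.
Proof.
move=> x y z; have [u ->] := classP x; have [v ->] := classP y.
by have [w ->] := classP z; rewrite !presented_mulE catA.
Qed.

Let mul1 : left_id presented_one presented_mul.
Proof. by move=> x; have [w ->] := classP x; rewrite presented_mulE. Qed.

Let mulr1 : right_id presented_one presented_mul.
Proof. by move=> x; have [w ->] := classP x; rewrite presented_mulE cats0. Qed.

Let mulV : left_inverse presented_one presented_inv presented_mul.
Proof.
move=> x; have [w ->] := classP x; rewrite presented_invE presented_mulE.
exact/word_classP/word_congr_mulV.
Qed.

Let mulrV : right_inverse presented_one presented_inv presented_mul.
Proof.
move=> x; have [w ->] := classP x; rewrite presented_invE presented_mulE.
by apply/word_classP; rewrite -{1}[w]inv_wordK; apply: word_congr_mulV.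
Qed.

HB.instance Definition _ :=
  isGroup.Build presented mulA mul1 mulr1 mulV mulrV.

Definition generator (s : S) : presented := word_class [:: (s, true)].

End PresentedGroup.

Definition free_group (k : nat) : groupType :=
  @presented 'I_k (fun _ => False).

Section Groups.
Local Open Scope group_scope.

Definition generated (G : groupType) (A : set G) : set G :=
  smallest (fun H : set G => group_closed (mem H)) A.

Definition isomorphic_to_subgroup (K G : groupType) (H : set G) : Prop :=
  exists f : {multiplicative K -> G}, injective f /\ range f = H.

Definition expgz (G : groupType) (x : G) (m : int) : G :=
  match m with
  | Posz n => x ^+ n
  | Negz n => x ^- n.+1
  end.

Definition share_nonzero_power (G : groupType) (x y : G) : Prop :=
  exists m n : int, [/\ m <> 0%R, n <> 0%R & expgz x m = expgz y n].

End Groups.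

Definition is_walk_length (T : eqType) (e : rel T) (x y : T) (n : nat) : Prop :=
  exists p : seq T, [/\ path e x p, last x p = y & size p = n].

(* The graph metric; the value is 0, by convention, when no walk joins x to y. *)
Definition graph_dist (T : eqType) (e : rel T) (x y : T) : nat :=
  if pselect (exists n, `[< is_walk_length e x y n >]) is left h
  then ex_minn h else 0.

Section RAAG.
Local Open Scope group_scope.
Variables (V : finType) (e : rel V).

Definition raag_relator (w : word V) : Prop :=
  exists a b : V,
    e a b /\ w = [:: (a, false); (b, false); (a, true); (b, true)].

Definition raag : groupType := @presented V raag_relator.

Definition raag_gen (v : V) : raag := generator raag_relator v.

Definition ext_vertices : set raag :=
  [set x | exists (v : V) (g : raag), x = raag_gen v ^ g].

Definition ext_adj : rel ext_vertices :=
  fun x y => (x != y) && (val x * val y == val y * val x).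

Lemma ext_act_subproof (x : ext_vertices) (g : raag) :
  val x ^ g \in ext_vertices.
Proof.
case: x => x /= /set_mem [v [h ->]]; apply/mem_set; exists v, (h * g).
by rewrite conjgM.
Qed.

Definition ext_act (x : ext_vertices) (g : raag) : ext_vertices :=
  SigSub (ext_act_subproof x g).

(* When e is connected and V is nonempty, the limit exists for every base point
   x and does not depend on it. *)
Definition loxodromic (R : realType) (g : raag) : Prop :=
  exists (x : ext_vertices) (L : R), (0 < L)%R /\
    (fun n : nat =>
       (n%:R^-1 * (graph_dist ext_adj x (ext_act x (g ^+ n)))%:R)%R : R)
      @ \oo --> L.

End RAAG.

(* Main.v *)
From HB Require Import structures.
Require Import Defs.
From mathcomp Require Import all_boot all_order all_algebra.
From mathcomp Require Import boolp classical_sets reals topology normedtype.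
From mathcomp Require Import sequences.

Set Implicit Arguments.
Unset Strict Implicit.
Unset Printing Implicit Defensive.

Local Open Scope classical_set_scope.
Local Open Scope group_scope.

(** The proof is a ping-pong argument on halfspaces.  Let [A] be the
    right-angled Artin group of the graph.  For a letter [l] (a generator or
    its inverse) let [first_letter l] be the set of elements that have a
    reduced expression starting with [l]; the translates of these sets are the
    halfspaces of the Cayley graph of [A], and each edge of the Cayley graph
    enters exactly one of them.  Hence the number of halfspaces separating two
    elements is their word distance: it is finite, and balls are finite
    ([raag_wallspace]).

    Halfspaces see the extension graph: to a translate of [first_letter l]
    corresponds a conjugate of the generator of [l], and when two halfspaces
    cross, the two conjugates commute ([cross_halfspaces]), so that they are
    equal or adjacent in the extension graph.  A nontrivial element [g] moves
    some halfspace [H] strictly inside itself ([exists_skewered]).  If, for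
    every [p], some halfspace crossed both [H] and [g ^+ p H], the vertex of
    [H] would move by at most two under all powers of [g]; this is impossible
    for a loxodromic [g].  So a loxodromic [g] has a power [a] and a halfspace
    [H] with [a H] strictly inside [H], such that no halfspace crosses both [H]
    and [a H] ([loxodromic_axial]): the chain of the [a ^+ m H] is an axis with
    strongly separated walls.

    Consider two such axes, [(a, H)] and [(b, K)].  If [a ^+ m H] meets
    [b ^+ n K] for all [m] and [n], strong separation forces the two chains to be
    nested in each other alternately, at a bounded rate.  A halfspace that
    separates [a ^+ m] from the point [b ^+ n] at the same height is then
    trapped in a bounded part of one of the two axes, so the words
    [a ^- m * b ^+ n] have bounded length; two of them coincide, and [a] and [b] have a
    common power ([common_end]).

    So if the loxodromic elements pairwise share no power, then deep enough
    halfspaces along the two ends of all axes are pairwise disjoint, and large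
    powers play ping-pong on them ([powers_free]).

    The halfspaces are obtained from an action of [A] on pilings: a piling
    stores one stack of signs and blanks per vertex, a letter pushes its sign
    on its own stack and a blank on each stack of a vertex that does not
    commute with it, and the top of the stacks shows the possible first letters
    of the reduced expressions. *)

(** * Halfspaces in a group *)

Section Halfspaces.
Variable G : groupType.
Implicit Types (g x y : G) (A B H J K : set G).

Definition translate g H : set G := [set x | H (g^-1 * x)].

Lemma translateE g H x : translate g H x = H (g^-1 * x). Proof. by []. Qed.

Lemma translateK g H x : translate g H (g * x) = H x.
Proof. by rewrite translateE mulKg. Qed.

Lemma translate1 H : translate 1 H = H.
Proof. by apply/funext => x; rewrite translateE invg1 mul1g. Qed.

Lemma translateM g h H : translate (g * h) H = translate g (translate h H).
Proof. by apply/funext => x; rewrite !translateE invgM mulgA. Qed.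

Lemma translateC g H : translate g (~` H) = ~` translate g H.
Proof. by []. Qed.

Lemma translate_sub g A B : A `<=` B -> translate g A `<=` translate g B.
Proof. by move=> AB x; apply: AB. Qed.

Lemma translate_subE g A B : translate g A `<=` translate g B -> A `<=` B.
Proof.
by move=> AB x Ax; rewrite -(translateK g); apply: AB; rewrite translateK.
Qed.

Definition cross A B :=
  [/\ A `&` B !=set0, A `&` ~` B !=set0,
      ~` A `&` B !=set0 & ~` A `&` ~` B !=set0].

Lemma cross_sym A B : cross A B -> cross B A.
Proof. by rewrite /cross ![B `&` _]setIC ![~` B `&` _]setIC => -[]. Qed.

Lemma crossCl A B : cross A B -> cross (~` A) B.
Proof. by rewrite /cross setCK => -[]. Qed.

Lemma crossCr A B : cross A B -> cross A (~` B).
Proof. by move=> /cross_sym/crossCl/cross_sym. Qed.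

Lemma cross_translate g A B :
  cross A B -> cross (translate g A) (translate g B).
Proof.
by move=> [] [x ?] [y ?] [z ?] [t ?]; split;
  [exists (g * x)|exists (g * y)|exists (g * z)|exists (g * t)];
  rewrite /setI /setC /= !translateK.
Qed.

Lemma cross_translateV g A B :
  cross A (translate g B) -> cross (translate g^-1 A) B.
Proof.
by move/(cross_translate g^-1); rewrite -translateM mulVg translate1.
Qed.

Lemma not_crossP A B : ~ cross A B ->
  [\/ A `<=` ~` B, A `<=` B, B `<=` A | ~` A `<=` B].
Proof.
move=> nAB; apply: contrapT => nsub; apply: nAB.
have not_sub C D : ~ (C `<=` D) -> C `&` ~` D !=set0.
  by move=> /existsNP[x] /not_implyP[Cx Dx]; exists x.
split; [rewrite -[B]setCK| |rewrite setIC|]; apply: not_sub => sub; apply: nsub;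
  [by constructor 1|by constructor 2|by constructor 3|by constructor 4].
Qed.

(** By invariance, separation is only expressed from the identity.  The last two
    fields say that the number of halfspaces separating two points is finite and
    is a proper function of the points; finiteness is given by a list containing
    the separating halfspaces, so that no count of them is needed. *)
Record wallspace (hs : set (set G)) : Prop := Wallspace {
  hs_translate : forall g H, hs H -> hs (translate g H);
  hs_compl : forall H, hs H -> hs (~` H);
  hs_finite : forall g, exists S : seq (set G),
    forall H, hs H -> ~ H 1 -> H g -> H \in S;
  hs_proper : forall C, exists B : seq G, forall g,
    (exists2 S : seq (set G), (size S <= C)%N &
       forall H, hs H -> ~ H 1 -> H g -> H \in S) -> g \in B }.

(** [a] pushes [H] into itself, with strong separation: no halfspace crosses
    both walls.  The translates of [H] by the powers of [a] play the role of an
    axis. *)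
Record axial (hs : set (set G)) (a : G) (H : set G) : Prop := Axial {
  axial_hs : hs H;
  axial_sub : translate a H `<=` H;
  axial_proper : ~ (H `<=` translate a H);
  axial_sep : forall J, hs J -> cross J H -> cross J (translate a H) -> False }.

End Halfspaces.

Section Axis.
Variables (G : groupType) (hs : set (set G)) (W : wallspace hs).
Implicit Types (a b g x y : G) (H J K : set G).

Lemma uniform_finite g : exists C, forall x, exists2 S : seq (set G),
  (size S <= C)%N & forall H, hs H -> ~ H x -> H (x * g) -> H \in S.
Proof.
have [S HS] := hs_finite W g; exists (size S) => x.
exists (map (translate x) S); first by rewrite size_map.
move=> H hH nH1 Hg; have -> : H = translate x (translate x^-1 H).
  by rewrite -translateM mulgV translate1.
apply: map_f; apply: HS; first exact: hs_translate.
- by rewrite translateE invgK mulg1.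
- by rewrite translateE invgK.
Qed.

(** The form in which finiteness is used: a family of distinct halfspaces that
    all separate [x] from [x * g] is bounded in terms of [g] alone. *)
Lemma no_long_chain C x g (F : nat -> set G) (S : seq (set G)) :
    (size S <= C)%N -> (forall H, hs H -> ~ H x -> H (x * g) -> H \in S) ->
    injective F -> (forall i, hs (F i)) ->
  ~ (forall i, (i <= C)%N -> ~ F i x /\ F i (x * g)).
Proof.
move=> sS HS injF hF sepF.
have : (size (map F (iota 0 C.+1)) <= size S)%N.
  apply: uniq_leq_size; first by rewrite (map_inj_uniq injF) iota_uniq.
  move=> K /mapP[i]; rewrite mem_iota ltnS => /= iC ->.
  by have [] := sepF i iC; apply: HS.
by rewrite size_map size_iota => /leq_trans/(_ sS); rewrite ltnn.
Qed.

Section OneAxis.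
Variables (a : G) (H : set G) (aH : axial hs a H).

Lemma axis_hs n : hs (translate (a ^+ n) H).
Proof. exact: (hs_translate W _ (axial_hs aH)). Qed.

Lemma axis_subS n : translate (a ^+ n.+1) H `<=` translate (a ^+ n) H.
Proof. by rewrite expgSr translateM; exact: (translate_sub (axial_sub aH)). Qed.

Lemma axis_sub m n : (m <= n)%N ->
  translate (a ^+ n) H `<=` translate (a ^+ m) H.
Proof.
elim: n => [|n IHn]; first by rewrite leqn0 => /eqP ->.
rewrite leq_eqVlt => /orP[/eqP -> //|/IHn mn].
by move=> x /axis_subS; apply: mn.
Qed.

Lemma axis_sub0 n : translate (a ^+ n) H `<=` H.
Proof. by rewrite -[X in _ `<=` X]translate1 -(expg0 a); apply: axis_sub. Qed.

Lemma axis_proper m n : (m < n)%N ->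
  ~ (translate (a ^+ m) H `<=` translate (a ^+ n) H).
Proof.
move=> mn mHn; apply: (axial_proper aH); apply: (translate_subE (g := a ^+ m)).
by rewrite -translateM -expgSr; move=> x /mHn; apply: axis_sub mn _.
Qed.

Lemma axis_inj : injective (fun n => translate (a ^+ n) H).
Proof.
move=> m n mn; apply: contrapT => /eqP; rewrite neq_ltn => /orP[] /axis_proper.
  by rewrite mn; apply.
by rewrite mn; apply.
Qed.

Lemma axis_sep n J : hs J ->
  cross J (translate (a ^+ n) H) -> cross J (translate (a ^+ n.+1) H) -> False.
Proof.
rewrite expgSr translateM => hJ /cross_translateV c1 /cross_translateV c2.
by apply: (axial_sep aH) c1 c2; apply: (hs_translate W).
Qed.

Lemma axial_translate n : axial hs a (translate (a ^+ n) H).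
Proof.
split; first exact: axis_hs.
- by rewrite -translateM -expgS; apply: axis_subS.
- by rewrite -translateM -expgS; apply: axis_proper.
- by move=> J hJ; rewrite -translateM -expgS; apply: axis_sep.
Qed.

Lemma axial_inv : axial hs a^-1 (~` H).
Proof.
have aV A : translate a (translate a^-1 A) = A.
  by rewrite -translateM mulgV translate1.
split; first exact: (hs_compl W (axial_hs aH)).
- apply: (translate_subE (g := a)); rewrite aV translateC; apply: subsetC.
  exact: axial_sub aH.
- move/(translate_sub (g := a)); rewrite aV translateC => /subsetC.
  rewrite !setCK.
  exact: axial_proper aH.
- move=> J hJ /crossCr; rewrite setCK => JH /crossCr.
  rewrite translateC setCK => JaH.
  apply: (axial_sep aH (J := translate a J)).
  + exact: (hs_translate W).
  + by move: (cross_translate a JaH); rewrite aV.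
  + exact: cross_translate.
Qed.

(** If [x] were in the whole chain, all its members would separate [x] from a
    point outside the first one. *)
Lemma axis_escape x : exists n, ~ translate (a ^+ n) H x.
Proof.
apply: contrapT => /forallNP allH.
have /existsNP[y /not_implyP[_ aHy]] := axial_proper aH.
have [C HC] := uniform_finite (y^-1 * x).
have [S sS HS] := HC y.
pose F i := translate (a ^+ i.+1) H.
apply: (no_long_chain (F := F) sS HS).
- by move=> i j /axis_inj[].
- by move=> i; apply: axis_hs.
- move=> i _; split; last by rewrite mulVKg; apply: contrapT (allH _).
  by rewrite -[a]expg1 in aHy; apply: contra_not aHy; apply: axis_sub.
Qed.

Lemma axis_infinite n : (0 < n)%N -> a ^+ n <> 1.
Proof.
by move=> n0 an; apply: (axis_proper n0); rewrite an.
Qed.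

End OneAxis.

(** The chain of the complements under [a^-1] also leaves every point behind. *)
Lemma axis_reach a H : axial hs a H -> exists c, H (a ^+ c).
Proof.
move=> /axial_inv/axis_escape/(_ 1)[c nHc]; exists c.
apply: contrapT => Hc; apply: nHc.
by rewrite translateE expVgn invgK mulg1.
Qed.

End Axis.

(** * Axes with the same end *)

Section Fellow.
Variables (G : groupType) (hs : set (set G)) (W : wallspace hs).
Implicit Types (J : set G).

Section TwoChains.
Variables (a b : G) (H K : set G).
Hypotheses (aH : axial hs a H) (bK : axial hs b K).
Hypotheses (H1 : ~ H 1) (K1 : ~ K 1).
Hypothesis meet :
  forall m n, translate (a ^+ m) H `&` translate (b ^+ n) K !=set0.

Let chainH m : ~ translate (a ^+ m) H (a ^+ m).
Proof. by rewrite translateE mulVg. Qed.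

Let chainK n : ~ translate (b ^+ n) K (b ^+ n).
Proof. by rewrite translateE mulVg. Qed.

Let not_cross_nested m n :
    ~ cross (translate (b ^+ n) K) (translate (a ^+ m) H) ->
  translate (b ^+ n) K `<=` translate (a ^+ m) H \/
  translate (a ^+ m) H `<=` translate (b ^+ n) K.
Proof.
move=> /not_crossP[disj|sub|sub|cov]; [|by left|by right|].
- by have [x [Hx Kx]] := meet m n; have := disj x Kx Hx.
- case: H1; apply: (axis_sub0 aH (n := m)); apply: cov => /(axis_sub0 bK).
  exact: K1.
Qed.

(** If the walls of [b ^+ n K] and [a ^+ m.+1 H] cross, then by strong
    separation the first one does not cross the wall of [a ^+ m H]; the two
    halfspaces meet and both miss the identity, so they are nested. *)
Lemma interleave m n :
  translate (b ^+ n) K `<=` translate (a ^+ m) H \/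
  translate (a ^+ m.+1) H `<=` translate (b ^+ n) K.
Proof.
have [crS|ncrS] :=
    pselect (cross (translate (b ^+ n) K) (translate (a ^+ m.+1) H)).
  have /not_cross_nested[?|sub] :
      ~ cross (translate (b ^+ n) K) (translate (a ^+ m) H).
  - by move=> cr; apply: (axis_sep W aH _ cr crS); apply: (axis_hs W bK).
  - by left.
  - by right=> x /(axis_subS aH)/sub.
have [sub|?] := not_cross_nested ncrS; last by right.
by left=> x /sub/(axis_subS aH).
Qed.

(** If this fails for a large [c], then [a ^+ m.+3 H] is contained in
    [b ^+ (n + C) K] for a large [C], and then all the
    [b ^+ (n + i) K] with [i <= C] separate [a ^+ m] from a later point of the
    first axis at a fixed distance. *)
Lemma catch_up : exists c, forall m n, ~ translate (b ^+ n) K (a ^+ m) ->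
  translate (a ^+ m.+2) H (b ^+ (n + c)).
Proof.
have [cH HcH] := axis_reach W aH; have [cK KcK] := axis_reach W bK.
have [C HC] := uniform_finite W (a ^+ (cH + 3)).
exists (C + cK)%N => m n nK.
have [sub|sub] := interleave m.+2 (n + C).
  by apply: sub; rewrite addnA (expgnDr _ (n + C)) translateK.
have [S sS HS] := HC (a ^+ m).
have [] := no_long_chain (F := fun i => translate (b ^+ (n + i)) K) sS HS.
- by move=> i j /(axis_inj bK)/addnI.
- by move=> i; apply: (axis_hs W bK).
- move=> i iC; split.
    by apply: contra_not nK; apply: (axis_sub bK); rewrite leq_addr.
  have : translate (b ^+ (n + C)) K (a ^+ m * a ^+ (cH + 3)).
    by apply: sub; rewrite -expgnDr (_ : m + (cH + 3) = m.+3 + cH)%N;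
      [rewrite (expgnDr _ m.+3) translateK|rewrite addnCA addnC addn3].
  by apply: (axis_sub bK); rewrite leq_add2l.
Qed.

Lemma stay_behind m n :
    (forall j, (j < n)%N -> translate (b ^+ j) K (a ^+ m)) ->
  ~ translate (a ^+ m.+1) H (b ^+ n.-1).
Proof.
case: n => [_|n Kn] /=; first by move=> /(axis_sub0 aH).
have [sub|sub /sub] := interleave m n; last exact: chainK.
by case: (@chainH m); apply/sub/Kn.
Qed.

(** For [a ^+ m], let [n] be the first index with [a ^+ m] outside [b ^+ n K].
    A halfspace [J] that separates [a ^+ m] from [b ^+ n] does not cross both
    [a ^+ m.+1 H] and [a ^+ m.+2 H].  In each possible relative position of [J]
    and the one that it does not cross, [J] separates two nearby points of the
    same axis. *)
Lemma fellow_travel : exists C, forall m, exists n, exists2 S : seq (set G),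
  (size S <= C)%N &
  forall J, hs J -> ~ J (a ^+ m) -> J (b ^+ n) -> J \in S.
Proof.
have [c Hc] := catch_up; have [cH HcH] := axis_reach W aH.
have [C1 HC1] := uniform_finite W (a ^+ (cH + 2)).
have [C2 HC2] := uniform_finite W (b ^+ c).
have [C3 HC3] := uniform_finite W b.
exists (C1 + C2 + C3)%N => m.
have exn : exists n, `[< ~ translate (b ^+ n) K (a ^+ m) >].
  by have [n ?] := axis_escape W bK (a ^+ m); exists n; apply/asboolP.
have [n /asboolP nK minn] := ex_minnP exn.
have Kn j : (j < n)%N -> translate (b ^+ j) K (a ^+ m).
  move=> jn; apply: contrapT => /asboolP/minn.
  by rewrite leqNgt jn.
exists n; have [S1 sS1 HS1] := HC1 (a ^+ m).
have [S2 sS2 HS2] := HC2 (b ^+ n); have [S3 sS3 HS3] := HC3 (b ^+ n.-1).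
exists (S1 ++ [seq ~` J | J <- S2] ++ S3).
  by rewrite !size_cat size_map addnA !leq_add.
move=> J hJ Ja Jb; rewrite !mem_cat.
have [k [km ncr]] : exists k, (k = m.+1 \/ k = m.+2) /\
    ~ cross J (translate (a ^+ k) H).
  have [cr|] := pselect (cross J (translate (a ^+ m.+1) H)); last first.
    by exists m.+1; auto.
  by exists m.+2; split; [right|move=> /(axis_sep W aH hJ cr)].
have mk : (m.+1 <= k <= m.+2)%N by case: km => ->; rewrite ?leqnn ?leqnSn.
have /andP[mk1 mk2] := mk.
have [disj|sub|sub|cov] := not_crossP ncr.
- (* [b ^+ n] is in [J], and [b ^+ (n + c)] is not. *)
  apply/orP; right; apply/orP; left.
  rewrite -[J]setCK; apply/map_f/HS2; first exact: (hs_compl W).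
    by move=> /(_ Jb).
  by rewrite -expgnDr => /disj; apply; apply: (axis_sub aH mk2); apply: Hc.
- (* [b ^+ n.-1] is not in [J], and [b ^+ n] is. *)
  apply/orP; right; apply/orP; right.
  have n0 : (0 < n)%N.
    rewrite lt0n; apply/eqP => n0; rewrite n0 in Jb.
    by case: H1; apply: (axis_sub0 aH (n := k)); apply: sub.
  apply: HS3 => //; last by rewrite -expgSr prednK.
  by move=> /sub/(axis_sub aH mk1); apply: stay_behind Kn.
- (* [a ^+ m] is not in [J], and [a ^+ (m + (cH + 2))] is. *)
  apply/orP; left; apply: HS1 => //; apply: sub; apply: (axis_sub aH mk2).
  by rewrite -expgnDr (_ : m + (cH + 2) = m.+2 + cH)%N;
      [rewrite (expgnDr _ m.+2) translateK|rewrite addnCA addnC addn2].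
- by case: (@chainH m); apply: (axis_sub aH _ (cov _ Ja)); apply: leq_trans mk1.
Qed.

End TwoChains.

Lemma expg_share_lt (a b : G) m m' n n' :
    (forall i, (0 < i)%N -> a ^+ i <> 1) ->
    (m < m')%N -> a ^- m * b ^+ n = a ^- m' * b ^+ n' ->
  share_nonzero_power a b.
Proof.
move=> a_inf mm' eq_mn.
have eq1 : a ^+ (m' - m) = b ^+ n' * b ^- n.
  apply: (mulgI (a ^- m')); rewrite mulgA -eq_mn mulgK expgnFr ?(ltnW mm') //.
  by rewrite mulKg.
have m0 : (0 < m' - m)%N by rewrite subn_gt0.
have [nn'|n'n] := leqP n n'.
  rewrite -expgnFr // in eq1.
  exists (Posz (m' - m)), (Posz (n' - n)); split=> //.
    by case=> mm0; rewrite mm0 in m0.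
  by case=> nn0; rewrite nn0 in eq1; apply: (a_inf _ m0).
exists (Posz (m' - m)), (Negz (n - n').-1); split=> //.
  by case=> mm0; rewrite mm0 in m0.
rewrite /= eq1 prednK ?subn_gt0 // expgnFr ?(ltnW n'n) //.
by rewrite invgM invgK.
Qed.

(** The hypothesis says that the two axes have the same end.  They then stay
    within a bounded distance of each other, balls are finite, and two of the
    elements [a ^- m * b ^+ n] coincide. *)
Theorem common_end (a b : G) (H K : set G) :
    axial hs a H -> axial hs b K ->
    (forall m n, translate (a ^+ m) H `&` translate (b ^+ n) K !=set0) ->
  share_nonzero_power a b.
Proof.
move=> aH bK meet.
have [m0 H1] := axis_escape W aH 1; have [n0 K1] := axis_escape W bK 1.
have [|C HC] :=
  fellow_travel (axial_translate W aH m0) (axial_translate W bK n0) H1 K1.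
  by move=> m n; rewrite -!translateM -!expgnDr.
have [B HB] := hs_proper W C.
have /choice[f Hf] m : exists n, a ^- m * b ^+ n \in B.
  have [n [S sS HS]] := HC m; exists n; apply: HB.
  exists (map (translate (a ^- m)) S); first by rewrite size_map.
  move=> J hJ J1 Jg; have -> : J = translate (a ^- m) (translate (a ^+ m) J).
    by rewrite -translateM mulVg translate1.
  apply/map_f/HS; first exact: (hs_translate W).
    by rewrite translateE mulVg.
  by rewrite translateE.
pose F m := a ^- m * b ^+ f m.
have [m [m' [mm' eqF]]] : exists m m', (m < m')%N /\ F m = F m'.
  apply: contrapT => nF.
  have injF : injective F.
    move=> m m' eqF; apply: contrapT => /eqP; rewrite neq_ltn => /orP[] lt.
      by apply: nF; exists m, m'.
    by apply: nF; exists m', m.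
  have : (size (map F (iota 0 (size B).+1)) <= size B)%N.
    apply: uniq_leq_size; first by rewrite (map_inj_uniq injF) iota_uniq.
    by move=> K0 /mapP[i _ ->]; apply: Hf.
  by rewrite size_map size_iota ltnn.
by apply: expg_share_lt mm' eqF => i; apply: (axis_infinite aH).
Qed.

End Fellow.

(** * Free groups from ping-pong *)

Section WordValue.
Variables (S : Type) (G : groupType) (f : S -> G).

Definition inv_letter (l : S * bool) : S * bool := (l.1, ~~ l.2).

Definition letter_val (l : S * bool) : G := if l.2 then f l.1 else (f l.1)^-1.

Definition word_val (w : word S) : G := \prod_(l <- w) letter_val l.

Lemma inv_letterK : involutive inv_letter.
Proof. by case=> s b; rewrite /inv_letter /= negbK. Qed.

Lemma letter_valV l : letter_val (inv_letter l) = (letter_val l)^-1.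
Proof. by case: l => s [] //=; rewrite /letter_val invgK. Qed.

Lemma word_val_nil : word_val [::] = 1.
Proof. exact: big_nil. Qed.

Lemma word_val_cons l w : word_val (l :: w) = letter_val l * word_val w.
Proof. exact: big_cons. Qed.

Lemma word_val_cat u v : word_val (u ++ v) = word_val u * word_val v.
Proof. exact: big_cat. Qed.

Lemma word_valV w : word_val (inv_word w) = (word_val w)^-1.
Proof.
elim: w => [|l w IHw]; first by rewrite word_val_nil invg1.
rewrite -cat1s inv_word_cat !word_val_cat IHw invgM; congr (_ * _).
by rewrite !word_val_cons word_val_nil !mulg1 -letter_valV.
Qed.

Lemma word_val_congr (rels : word S -> Prop) :
    (forall r, rels r -> word_val r = 1) ->
  forall u v, word_congr rels u v -> word_val u = word_val v.
Proof.
move=> rels1 u v; elim=> {u v} //.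
- by move=> u v w _ -> _ ->.
- by move=> u u' v v' _ uu' _ vv'; rewrite !word_val_cat uu' vv'.
- move=> s b; rewrite !word_val_cons word_val_nil mulg1.
  by rewrite (letter_valV (s, b)) mulgV.
- by move=> r /rels1 ->; rewrite word_val_nil.
Qed.

End WordValue.

Section FreeGroup.
Variables (k : nat) (G : groupType) (f : 'I_k -> G).

Definition free_lift (x : free_group k) : G := word_val f (repr x).

Lemma free_liftE w : free_lift (word_class _ w) = word_val f w.
Proof.
apply: (@word_val_congr _ _ _ (fun=> False)) => //.
by apply/word_classP; rewrite /word_class reprK.
Qed.

Lemma free_classP (x : free_group k) : exists w, x = word_class _ w.
Proof. by exists (repr x); rewrite /word_class reprK. Qed.

Lemma free_lift1 : free_lift 1 = 1.
Proof. by rewrite [X in free_lift X]/1 /= free_liftE word_val_nil. Qed.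

Lemma free_liftM : {morph free_lift : x y / x * y}.
Proof.
move=> x y; have [u ->] := free_classP x; have [v ->] := free_classP y.
rewrite [X in free_lift X](presented_mulE (fun=> False) u v).
by rewrite !free_liftE word_val_cat.
Qed.

HB.instance Definition _ :=
  isUMagmaMorphism.Build (free_group k) G free_lift
    (conj free_lift1 free_liftM).

Lemma range_free_lift : range free_lift = generated (range f).
Proof.
apply/seteqP; split=> [_ [x _ <-] M [[M1 MF] fM]|].
  have [w ->] := free_classP x; rewrite free_liftE.
  have MV y : M y -> M y^-1.
    by have := MF 1 y M1; rewrite !inE div1g.
  have MM y z : M y -> M z -> M (y * z).
    by move=> My /MV Mz; have := MF y z^-1; rewrite !inE invgK; apply.
  elim: w => [|l w IHw]; first by rewrite word_val_nil; move: M1; rewrite inE.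
  rewrite word_val_cons; apply: MM IHw; rewrite /letter_val.
  by case: l.2; [|apply: MV]; apply: fM; exists l.1.
apply: smallest_sub.
  split=> [|x y]; rewrite !inE.
    by exists 1 => //; exact: free_lift1.
  move=> [x' _ <-] [y' _ <-]; exists (x' / y') => //.
  by rewrite (gmulfF free_lift).
move=> _ [i _ <-]; exists (generator _ i) => //.
by rewrite free_liftE word_val_cons word_val_nil mulg1.
Qed.

Definition freely_reduced (w : word 'I_k) :=
  sorted (fun l m => m != inv_letter l) w.

Lemma free_reduction (w : word 'I_k) :
  exists2 u, freely_reduced u & word_congr (fun=> False) w u.
Proof.
elim: w => [|l w [u ru wu]]; first by exists [::] => //; apply: word_congr_refl.
have lwu : word_congr (fun=> False) (l :: w) (l :: u).
  by rewrite -[l :: w]cat1s -[l :: u]cat1s; apply: word_congr_cat wu;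
    apply: word_congr_refl.
case: u ru {wu} lwu => [|m u] ru lwu; first by exists [:: l].
have [ml|ml] := eqVneq m (inv_letter l); last first.
  by exists [:: l, m & u] => //; rewrite /freely_reduced /= ml.
exists u; first exact: path_sorted ru.
apply: word_congr_trans lwu _; rewrite ml.
rewrite -[[:: _, _ & u]]/([:: l; inv_letter l] ++ u).
rewrite -[X in word_congr _ _ X]cat0s.
apply: word_congr_cat; last exact: word_congr_refl.
by case: l {ml} => s b; apply: word_congr_cancel.
Qed.

(** A nonempty reduced word carries the identity into the set
    attached to its first letter, so that its value is not the identity. *)
Lemma ping_pong (U : 'I_k * bool -> set G) :
    (forall l, ~ U l 1) ->
    (forall l m x, U l x -> U m x -> l = m) ->
    (forall l x, ~ U (inv_letter l) x -> U l (letter_val f l * x)) ->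
  isomorphic_to_subgroup (free_group k) (generated (range f)).
Proof.
move=> U1 Udisj Upush; exists free_lift; split; last exact: range_free_lift.
have Uval l u : freely_reduced (l :: u) -> U l (word_val f (l :: u)).
  elim: u l => [|m u IHu] l.
    by rewrite word_val_cons word_val_nil => _; apply/Upush/U1.
  rewrite /freely_reduced /= => /andP[ml mu]; rewrite word_val_cons.
  apply: Upush => Ul; case/eqP: ml; apply: Udisj Ul.
  exact: IHu.
move=> x y fxy; apply: divg1_eq; have := gmulfF free_lift x y.
rewrite /= fxy mulgV; have [w ->] := free_classP (x / y).
have [u ru /word_classP ->] := free_reduction w; rewrite free_liftE.
by case: u ru => // l u /Uval Ul u1; case: (U1 l); rewrite -u1.
Qed.

End FreeGroup.

Section PowersFree.
Variables (G : groupType).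
Implicit Types (x y : G).

Lemma expgzN x (m : int) : expgz x (- m)%R = (expgz x m)^-1.
Proof.
by case: m => [[|n]|n]; rewrite ?NegzE ?GRing.opprK /= ?invg1 ?invgK.
Qed.

Lemma expgzX x p (m : int) : expgz (x ^+ p) m = expgz x (m * p%:Z)%R.
Proof.
case: m => n; first by rewrite -PoszM /= -expgnA mulnC.
by rewrite NegzE GRing.mulNr !expgzN -PoszM /= -expgnA mulnC.
Qed.

Lemma expgzV x (m : int) : expgz x^-1 m = expgz x (- m)%R.
Proof.
by rewrite expgzN; case: m => n /=; rewrite expVgn.
Qed.

Lemma share_nonzero_powerC x y :
  share_nonzero_power x y -> share_nonzero_power y x.
Proof. by move=> [m [n [? ? ?]]]; exists n, m. Qed.

Lemma share_nonzero_powerXl x y p : (0 < p)%N ->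
  share_nonzero_power (x ^+ p) y -> share_nonzero_power x y.
Proof.
case: p => // p _ [m [n [m0 n0 mn]]]; exists (m * p.+1%:Z)%R, n; split=> //.
  by move=> /eqP; rewrite GRing.mulf_eq0 => /orP[/eqP|].
by rewrite -expgzX.
Qed.

Lemma share_nonzero_powerVl x y :
  share_nonzero_power x^-1 y -> share_nonzero_power x y.
Proof.
move=> [m [n [m0 n0 mn]]]; exists (- m)%R, n; split=> //.
  by move=> /eqP; rewrite GRing.oppr_eq0 => /eqP.
by rewrite -expgzV.
Qed.

End PowersFree.

Lemma eventually_all (T : finType) (P : T -> nat -> Prop) :
    (forall t, exists n, forall m, (n <= m)%N -> P t m) ->
  exists n, forall t m, (n <= m)%N -> P t m.
Proof.
move=> /choice[f Pf]; exists (\max_t f t)%N => t m fm; apply: Pf.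
exact: leq_trans (leq_bigmax t) fm.
Qed.

(** The ping-pong sets are, for each letter [l] and a large [M], the [M]-th
    member of the chain at the end of the axis towards which [l] moves.  They
    are disjoint for different axes by [common_end], and for the two ends of
    one axis because they lie on different sides of its first halfspace.  A
    power [N] of the letter moves the complement of the set at one end into the
    set at the other end as soon as [M + M <= N]. *)
Theorem powers_free (G : groupType) (hs : set (set G)) (k : nat)
    (lambda : 'I_k -> G) (H : 'I_k -> set G) (p : 'I_k -> nat) :
    wallspace hs ->
    (forall i, translate (lambda i) (H i) `<=` H i) ->
    (forall i, (0 < p i)%N) ->
    (forall i, axial hs (lambda i ^+ p i) (H i)) ->
    (forall i j, i <> j -> ~ share_nonzero_power (lambda i) (lambda j)) ->
  exists N0, forall N, (N0 <= N)%N ->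
    isomorphic_to_subgroup (free_group k)
      (generated (range (fun i => lambda i ^+ N))).
Proof.
move=> W lH p0 axH indep.
pose a := letter_val lambda.
pose A (l : 'I_k * bool) := if l.2 then H l.1 else ~` H l.1.
have aA l : axial hs (a l ^+ p l.1) (A l).
  case: l => i []; first exact: axH.
  by rewrite /a /letter_val /= expVgn; apply: axial_inv.
have aS l : translate (a l) (A l) `<=` A l.
  case: l => i []; first exact: lH.
  apply: (@translate_subE _ (lambda i)); rewrite -translateM mulgV translate1.
  by rewrite translateC; apply: subsetC; apply: lH.
have AV l : A (inv_letter l) = ~` A l.
  by case: l => i [] //; rewrite /A /= setCK.
pose U M l := translate (a l ^+ M) (A l).
have UM M N l : (M <= N)%N -> U N l `<=` U M l.
  elim: N => [|N IHN]; first by rewrite leqn0 => /eqP ->.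
  rewrite leq_eqVlt => /orP[/eqP -> //|/IHN NM] x Ux; apply: NM.
  by move: x Ux; rewrite /U expgSr translateM; exact: (translate_sub (aS l)).
have U0 M l : U M l `<=` A l.
  by have := @UM 0 M l isT; rewrite {2}/U expg0 translate1.
have [M1 HM1] : exists M1, forall l M, (M1 <= M)%N -> ~ U M l 1.
  apply: (@eventually_all _ (fun l M => ~ U M l 1)) => l.
  have [n] := axis_escape W (aA l) 1.
  by rewrite -expgnA => nU; exists (p l.1 * n)%N => M nM /(UM _ _ _ nM).
have [M2 HM2] : exists M2, forall t M, (M2 <= M)%N ->
    forall x, U M t.1 x -> U M t.2 x -> t.1 = t.2.
  apply: (@eventually_all _ (fun t M =>
    forall x, U M t.1 x -> U M t.2 x -> t.1 = t.2)) => -[l m] /=.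
  have [lm|lm] := eqVneq l.1 m.1.
    exists 0 => M _ x /U0 lx /U0 mx; apply: contrapT => neq_lm.
    have ml : m = inv_letter l.
      case: l m lm {lx mx} neq_lm => i b [j c] /= <- neq_bc.
      by congr (_, _); case: b c neq_bc => [] [] //= neq_bc; case: neq_bc.
    by move: mx; rewrite ml AV.
  have /existsNP[n /existsNP[n' disj]] : ~ forall n n',
      translate (a l ^+ p l.1 ^+ n) (A l) `&`
      translate (a m ^+ p m.1 ^+ n') (A m) !=set0.
    move=> /(common_end W (aA l) (aA m)) /share_nonzero_powerXl -/(_ (p0 _)).
    move=> /share_nonzero_powerC/share_nonzero_powerXl -/(_ (p0 _)) sh.
    have sh' : share_nonzero_power (lambda m.1) (a l).
      move: sh; rewrite /a {1}/letter_val; case: m.2 => //.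
      exact: share_nonzero_powerVl.
    move/share_nonzero_powerC: sh' => sh'.
    apply: (indep _ _ (elimN eqP lm)).
    move: sh'; rewrite /a /letter_val; case: l.2 => //.
    exact: share_nonzero_powerVl.
  exists (maxn (p l.1 * n) (p m.1 * n')) => M; rewrite geq_max => /andP[nM n'M].
  move=> x /(UM _ _ _ nM) lx /(UM _ _ _ n'M) mx; case: disj; exists x.
  by split; rewrite -expgnA.
pose M := maxn M1 M2; exists (M + M)%N => N MN.
apply: (@ping_pong _ _ _ (U M)).
- by move=> l; apply: HM1; rewrite leq_maxl.
- by move=> l m x; apply: (HM2 (l, m)); rewrite leq_maxr.
- move=> l x; have -> : letter_val (fun i => lambda i ^+ N) l = a l ^+ N.
    by rewrite /a /letter_val; case: l.2; rewrite ?expVgn.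
  have MN' : (M <= N)%N by apply: leq_trans MN; rewrite leq_addr.
  rewrite /U AV /a letter_valV -/a => /contrapT Ux.
  have : U (N - M)%N l (a l ^+ N * x).
    rewrite /U translateE expgnFr // invgF mulgA.
    by rewrite mulgVK; move: Ux; rewrite expVgn invgK.
  by apply: UM; rewrite leq_subRL // -maxnE.
Qed.

(** * Pilings *)

Section RightAngledArtin.
Variables (V : finType) (e : rel V).
Hypotheses (e_sym : symmetric e) (e_irr : irreflexive e).
Implicit Types (l m : V * bool) (p q : {ffun V -> seq (option bool)}).

(** One stack per vertex, with its top at the head of the list: [Some b] stands
    for a letter of that vertex with sign [b], and [None] for a letter of
    another vertex that does not commute with it. *)
Definition piling := {ffun V -> seq (option bool)}.

Definition top p (v : V) : option bool := head None (p v).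

Definition push l p : piling :=
  [ffun w => if w == l.1 then Some l.2 :: p w
             else if e w l.1 then p w else None :: p w].

Definition pop (v : V) p : piling :=
  [ffun w => if (w == v) || ~~ e w v then behead (p w) else p w].

Definition act_letter l p : piling :=
  if top p l.1 == Some (~~ l.2) then pop l.1 p else push l p.

Definition act (w : word V) p : piling := foldr act_letter p w.

Definition empty_piling : piling := [ffun=> [::]].

(** The pilings of the elements of the group.  Without this restriction pushing
    would not undo popping, which removes the tops of other stacks without
    looking at them. *)
Inductive legal : piling -> Prop :=
| legal_empty : legal empty_piling
| legal_push l p : legal p -> top p l.1 != Some (~~ l.2) -> legal (push l p).

Lemma push_top l p : top (push l p) l.1 = Some l.2.
Proof. by rewrite /top ffunE eqxx. Qed.

Lemma push_top_adj l p v : e l.1 v -> top (push l p) v = top p v.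
Proof.
move=> lv; rewrite /top ffunE e_sym lv; case: eqP => // vl.
by rewrite vl e_irr in lv.
Qed.

Lemma push_top_far l p v : v != l.1 -> ~~ e l.1 v -> top (push l p) v = None.
Proof. by move=> vl lv; rewrite /top ffunE (negPf vl) e_sym (negPf lv). Qed.

Lemma pop_push l p : pop l.1 (push l p) = p.
Proof.
apply/ffunP => w; rewrite !ffunE; case: eqP => //= _.
by case: (e w l.1).
Qed.

Lemma pushC l m p : e l.1 m.1 -> push l (push m p) = push m (push l p).
Proof.
move=> lm; apply/ffunP => w; rewrite !ffunE.
have [->|wl] := eqVneq w l.1.
  rewrite lm; case: eqP => // l_m; by rewrite l_m e_irr in lm.
by have [->|wm] := eqVneq w m.1; [rewrite e_sym lm|do 2!case: ifP].
Qed.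

(** A letter on top of its stack can be taken to be the last one pushed: the
    letters pushed after it commute with it. *)
Lemma legal_top p l : legal p -> top p l.1 = Some l.2 ->
  exists q, [/\ p = push l q, legal q & top q l.1 != Some (~~ l.2)].
Proof.
move=> ls; elim: ls l => [l|m {}p ls IHs ms l]; first by rewrite /top ffunE.
have [lm|lm] := eqVneq l.1 m.1.
  rewrite lm push_top => -[ml].
  have -> : l = m by apply/pair_eqP/andP; split; apply/eqP.
  by exists p.
have [ml|ml] := boolP (e m.1 l.1); last by rewrite push_top_far.
rewrite push_top_adj // => /IHs[q [s_t lt tl]].
exists (push m q); split; last by rewrite push_top_adj.
- by rewrite s_t pushC.
- by apply: legal_push => //; move: ms; rewrite s_t push_top_adj // e_sym.
Qed.

Variant act_spec l p : piling -> Prop :=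
| ActPop q : p = push (inv_letter l) q -> legal q ->
    top q l.1 != Some l.2 -> act_spec l p q
| ActPush : top p l.1 != Some (~~ l.2) -> act_spec l p (push l p).

Lemma actP l p : legal p -> act_spec l p (act_letter l p).
Proof.
move=> ls; rewrite /act_letter; case: eqP => [sl|/eqP sl]; last exact: ActPush.
have [q [s_t lt tl]] := legal_top (l := inv_letter l) ls sl.
rewrite s_t (pop_push (inv_letter l)) -s_t; apply: ActPop => //.
by rewrite /= negbK in tl.
Qed.

Lemma act_letter_legal l p : legal p -> legal (act_letter l p).
Proof. by move=> ls; case: (actP l ls) => // sl; apply: legal_push. Qed.

Lemma act_legal w p : legal p -> legal (act w p).
Proof. by move=> ls; elim: w => //= l w; apply: act_letter_legal. Qed.

Lemma act_letter_push l p : top p l.1 != Some (~~ l.2) ->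
  act_letter l p = push l p.
Proof. by rewrite /act_letter => /negPf ->. Qed.

Lemma act_letter_pop l p : act_letter l (push (inv_letter l) p) = p.
Proof.
by rewrite /act_letter (push_top (inv_letter l)) eqxx (pop_push (inv_letter l)).
Qed.

Lemma act_cancel l p :
  legal p -> act_letter l (act_letter (inv_letter l) p) = p.
Proof.
move=> ls; case: (actP (inv_letter l) ls) => [q -> lt tl|sl].
  by rewrite inv_letterK; apply: act_letter_push.
exact: act_letter_pop.
Qed.

Lemma act_top_adj l p v :
  legal p -> e l.1 v -> top (act_letter l p) v = top p v.
Proof.
move=> ls lv; case: (actP l ls) => [q -> lt tl|sl]; last exact: push_top_adj.
by rewrite (@push_top_adj (inv_letter l)).
Qed.

Lemma actC l m p : legal p -> e l.1 m.1 ->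
  act_letter l (act_letter m p) = act_letter m (act_letter l p).
Proof.
move=> ls lm; have ml : e m.1 l.1 by rewrite e_sym.
case: (actP m ls) => [q s_t lt tm|sm].
  rewrite s_t; case: (actP l lt) => [u t_u lu ul|tl].
    rewrite t_u (@pushC _ (inv_letter l)) // act_letter_pop.
    by rewrite act_letter_pop.
  rewrite (@act_letter_push l) ?push_top_adj //.
  by rewrite pushC // act_letter_pop.
case: (actP l ls) => [q s_t lt tl|sl].
  rewrite s_t pushC // act_letter_pop act_letter_push //.
  by move: sm; rewrite s_t push_top_adj.
by rewrite !act_letter_push ?push_top_adj // pushC.
Qed.

Lemma act_congr u v : word_congr (raag_relator e) u v ->
  forall p, legal p -> act u p = act v p.
Proof.
elim=> {u v} //.
- by move=> u v _ IH p ls; rewrite IH.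
- by move=> v u w _ IH1 _ IH2 p ls; rewrite IH1 ?IH2.
- move=> u u' v v' _ IH1 _ IH2 p ls; rewrite /act !foldr_cat -!/(act _ _).
  by rewrite IH2 // IH1 //; apply: act_legal.
- by move=> x b p ls; apply: (@act_cancel (x, b)).
- move=> w [a [b [ab ->]]] p ls /=.
  rewrite (@actC (b, false)) // ?(@act_cancel (b, false));
    rewrite ?(@act_cancel (a, false)) //; do ?exact: act_letter_legal.
  by rewrite e_sym.
Qed.

Definition piling_of (g : raag e) : piling := act (repr g) empty_piling.

Lemma piling_of_class w :
  piling_of (word_class (raag_relator e) w) = act w empty_piling.
Proof.
apply: act_congr legal_empty; apply/word_classP.
by rewrite /word_class reprK.
Qed.

Lemma piling_of_legal g : legal (piling_of g).
Proof. exact/act_legal/legal_empty. Qed.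

(** * The halfspaces of a right-angled Artin group *)

Notation gen := (letter_val (raag_gen e)).

Definition first_letter l : set (raag e) :=
  [set g | top (piling_of g) l.1 = Some l.2].

Lemma raag_classP (g : raag e) : exists w, g = word_class (raag_relator e) w.
Proof. by exists (repr g); rewrite /word_class reprK. Qed.

Lemma gen_class l : gen l = word_class (raag_relator e) [:: l].
Proof.
case: l => v [] //; rewrite /letter_val /=.
by rewrite [LHS](presented_invE (raag_relator e) [:: (v, true)]).
Qed.

Lemma word_valE w : word_val (raag_gen e) w = word_class (raag_relator e) w.
Proof.
elim: w => [|l w IHw]; first exact: word_val_nil.
by rewrite word_val_cons IHw gen_class [LHS](presented_mulE (raag_relator e)).
Qed.

Lemma piling_of_genM l g : piling_of (gen l * g) = act_letter l (piling_of g).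
Proof.
have [w ->] := raag_classP g; rewrite -word_valE -word_val_cons !word_valE.
by rewrite !piling_of_class.
Qed.

Lemma first_letter1 l : ~ first_letter l 1.
Proof.
rewrite /first_letter /= -(word_val_nil (raag_gen e)) word_valE.
by rewrite piling_of_class /= /top ffunE.
Qed.

(** Left multiplication by [l] maps the complement of the halfspace of the
    inverse letter onto the halfspace of [l]. *)
Lemma first_letter_genM l g :
  first_letter l (gen l * g) <-> ~ first_letter (inv_letter l) g.
Proof.
rewrite /first_letter /= piling_of_genM.
case: (actP l (piling_of_legal g)) => [q -> lq ql|/eqP pl].
  by rewrite (push_top (inv_letter l)); split=> // /eqP; rewrite (negPf ql).
by rewrite push_top.
Qed.

Lemma first_letter_adj l m g : e m.1 l.1 ->
  first_letter l (gen m * g) <-> first_letter l g.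
Proof.
move=> ml; rewrite /first_letter /= piling_of_genM act_top_adj //.
exact: piling_of_legal.
Qed.

(** A letter on top of its stack has put a blank on top of the stacks of all
    vertices that do not commute with it. *)
Lemma first_letter_commute l m g :
  first_letter l g -> first_letter m g -> l <> m -> e l.1 m.1.
Proof.
rewrite /first_letter /= => gl gm; apply: contra_notP => /negP lm.
have [q [g_q _ _]] := legal_top (piling_of_legal g) gl.
move: gm; have [ml|ml] := eqVneq m.1 l.1; last by rewrite g_q push_top_far.
by rewrite ml gl => -[bl]; case: l m bl ml {gl lm g_q} => ? ? [? ?] /= -> ->.
Qed.

Lemma gen_commute l m : e l.1 m.1 -> commute (gen l) (gen m).
Proof.
have comm v w : e v w -> commute (raag_gen e v) (raag_gen e w).
  move=> vw; apply/commgP/eqP; have <- : word_val (raag_gen e)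
      [:: (v, false); (w, false); (v, true); (w, true)] = 1.
    by rewrite word_valE; apply/word_classP/word_congr_rel; exists v, w.
  by rewrite !word_val_cons word_val_nil mulg1 commgEl conjgE.
move=> /comm lm; rewrite /letter_val; case: l.2; case: m.2 => //;
  [exact: commuteV|apply/commute_sym|apply/commuteV/commute_sym];
  exact/commuteV/commute_sym.
Qed.


Notation val_of := (word_val (raag_gen e)).

(** Reducedness is read off the halfspaces, so that it implies at once that the
    first letter of the word is a first letter of its value. *)
Fixpoint reduced (w : word V) : Prop :=
  if w is l :: u then ~ first_letter (inv_letter l) (val_of u) /\ reduced u
  else True.

Lemma first_letter_cons l w :
  reduced (l :: w) -> first_letter l (val_of (l :: w)).
Proof. by case=> nl _; rewrite word_val_cons; apply/first_letter_genM. Qed.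

Lemma first_letter_nil l : ~ first_letter l (val_of [::]).
Proof. by rewrite word_val_nil; apply: first_letter1. Qed.

Lemma first_letter_mem w l : reduced w -> first_letter l (val_of w) -> l \in w.
Proof.
elim: w => [|m w IHw] rw lw; first by case: (first_letter_nil lw).
rewrite inE; have [//|lm] := eqVneq l m.
have ml : e m.1 l.1.
  apply: (first_letter_commute (first_letter_cons rw) lw) => ml.
  by rewrite ml eqxx in lm.
rewrite word_val_cons in lw; apply: IHw; first by case: rw.
exact/(first_letter_adj _ ml).
Qed.

(** A first letter commutes with every letter that precedes it in a reduced
    word, and so it can be moved to the front. *)
Lemma reduced_exchange w l : reduced w -> first_letter l (val_of w) ->
  exists2 u, reduced u & val_of w = gen l * val_of u.
Proof.
elim: w l => [|m w IHw] l rw lw; first by case: (first_letter_nil lw).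
have [<-|lm] := eqVneq m l.
  by exists w; [case: rw|rewrite word_val_cons].
have ml : e m.1 l.1.
  by apply: (first_letter_commute (first_letter_cons rw) lw); apply/eqP.
rewrite word_val_cons in lw *; case: rw => mw rw.
have [u ru wu] := IHw l rw ((first_letter_adj _ ml).1 lw).
exists (m :: u).
  split=> //; move: mw; rewrite wu; apply: contra_not => mu.
  by apply/first_letter_adj => //; rewrite e_sym.
by rewrite wu word_val_cons !mulgA (gen_commute ml).
Qed.

Lemma exists_reduced g : exists2 w, reduced w & g = val_of w.
Proof.
have [w ->] := raag_classP g; rewrite -word_valE.
elim: w => [|l w [u ru wu]]; first by exists [::].
rewrite word_val_cons wu.
have [lu|lu] := pselect (first_letter (inv_letter l) (val_of u)).
  have [v rv ->] := reduced_exchange ru lu; exists v => //.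
  by rewrite letter_valV mulVKg.
by exists (l :: u) => //; rewrite word_val_cons.
Qed.

Lemma word_commute l w : all (fun m => e l.1 m.1) w ->
  commute (gen l) (val_of w).
Proof.
elim: w => [|m w IHw] /=; first by rewrite word_val_nil => _; apply: commute1.
move=> /andP[/gen_commute lm /IHw lw]; rewrite word_val_cons.
exact: commuteM.
Qed.

(** The edges entering [first_letter t] all have the label [t] and are based at
    the subgroup generated by the neighbours of [t].  Indeed, let [r] be the
    first letter of the base point.  If [r] does not commute with [t], the
    halfspaces of [r] and [t] are disjoint and the edge also leaves the
    halfspace of [r]; by induction the edge deletes [r] from the base point and
    all the other letters are neighbours of [r]; but [t] would be one of them. *)
Lemma edge_crossing_word w s t : reduced w ->
    ~ first_letter t (val_of w) -> first_letter t (val_of w * gen s) ->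
  s = t /\ all (fun m => e t.1 m.1) w.
Proof.
elim: w t => [|r w IHw] t rw.
  rewrite word_val_nil mul1g => _ ts; split=> //; apply: contrapT => st.
  have ss : first_letter s (gen s).
    by rewrite -[gen s]mulg1; apply/first_letter_genM/first_letter1.
  have /first_letter_adj adj := first_letter_commute ss ts st.
  by move: ts; rewrite -[gen s]mulg1 => /adj; apply: first_letter1.
have rr := first_letter_cons rw; case: rw => nrw rw.
rewrite word_val_cons in rr *; rewrite -mulgA => ntw tws.
have rt : r <> t by move=> rt; apply: ntw; rewrite -rt.
have [adj|far] := boolP (e r.1 t.1).
  have [||-> tw] := IHw t rw.
  - by apply: contra_not ntw; apply: (first_letter_adj _ adj).2.
  - exact: (first_letter_adj _ adj).1 tws.
  - by rewrite /= e_sym adj.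
have [|sr wr] := IHw (inv_letter r) rw nrw.
  apply: contrapT => /first_letter_genM rws; case/negP: far.
  exact: first_letter_commute rws tws rt.
have tw : first_letter t (val_of w).
  have -> : val_of w = gen r * (val_of w * gen s); last exact: tws.
  by rewrite sr letter_valV mulgA (word_commute (l := r) wr) mulgK.
by case/negP: far; apply: (allP wr); apply: first_letter_mem.
Qed.

Lemma translate_adj l m : e m.1 l.1 ->
  translate (gen m) (first_letter l) = first_letter l.
Proof.
move=> ml; apply/seteqP; split=> x; rewrite translateE.
  by move/(first_letter_adj _ ml); rewrite mulVKg.
by move=> lx; apply/(first_letter_adj _ ml); rewrite mulVKg.
Qed.

Lemma edge_crossing y s t :
    ~ first_letter t y -> first_letter t (y * gen s) ->
  [/\ s = t, commute y (gen t) & translate y (first_letter t) = first_letter t].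
Proof.
have [w rw ->] := exists_reduced y => nt ts.
have [st wt] := edge_crossing_word rw nt ts; split=> //.
  exact/commute_sym/word_commute.
elim: w wt {rw nt ts} => [|m w IHw] /=.
  by rewrite word_val_nil translate1.
move=> /andP[tm /IHw IH]; rewrite word_val_cons translateM IH.
by rewrite translate_adj // e_sym.
Qed.

Lemma first_letterC l :
  ~` first_letter l = translate (gen l) (first_letter (inv_letter l)).
Proof.
apply/seteqP; split=> x; rewrite translateE;
  have := first_letter_genM l ((gen l)^-1 * x).
  by rewrite mulVKg => xl nx; apply: contrapT => /xl.
by rewrite mulVKg => xl nx /xl.
Qed.

Definition halfspaces : set (set (raag e)) :=
  [set K | exists g l, K = translate g (first_letter l)].

Lemma halfspaces_translate g K : halfspaces K -> halfspaces (translate g K).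
Proof. by move=> [h [l ->]]; exists (g * h), l; rewrite translateM. Qed.

Lemma halfspacesC K : halfspaces K -> halfspaces (~` K).
Proof.
move=> [g [l ->]]; exists (g * gen l), (inv_letter l).
by rewrite translateM -first_letterC.
Qed.

(** The halfspaces entered along an edge of the Cayley graph are all equal,
    because the base points of the edges entering [first_letter t] stabilize
    it. *)
Lemma halfspace_edge K y s : halfspaces K -> ~ K y -> K (y * gen s) ->
  K = translate y (first_letter s).
Proof.
move=> [g [t ->]]; rewrite !translateE mulgA => nt ts.
have [-> _ tr] := edge_crossing nt ts.
by rewrite -[in LHS]tr -translateM mulVKg.
Qed.

(** The halfspaces entered by the successive edges of the path from [x] spelled
    by the word. *)
Fixpoint walls (x : raag e) (w : word V) : seq (set (raag e)) :=
  if w is s :: u then translate x (first_letter s) :: walls (x * gen s) u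
  else [::].

Lemma size_walls x w : size (walls x w) = size w.
Proof. by elim: w x => //= s w IHw x; rewrite IHw. Qed.

Lemma walls_complete x w K : halfspaces K -> ~ K x -> K (x * val_of w) ->
  K \in walls x w.
Proof.
move=> hK; elim: w x => [|s w IHw] x nKx; first by rewrite word_val_nil mulg1.
rewrite word_val_cons mulgA inE => Kxw.
have [Kxs|nKxs] := pselect (K (x * gen s)); last by rewrite IHw ?orbT.
by rewrite (halfspace_edge hK nKx Kxs) eqxx.
Qed.

Lemma walls_halfspaces x w K : K \in walls x w -> halfspaces K.
Proof.
elim: w x => //= s w IHw x; rewrite inE => /orP[/eqP ->|/IHw //].
by exists x, s.
Qed.

(** Along a reduced word no halfspace is entered and left again. *)
Lemma walls_separate x w K : reduced w -> K \in walls x w ->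
  ~ K x /\ K (x * val_of w).
Proof.
elim: w x => //= s w IHw x [nsw rw]; rewrite inE word_val_cons.
have sw : first_letter s (gen s * val_of w) by apply/first_letter_genM.
move=> /orP[/eqP ->|Kw]; first by rewrite !translateE mulVg mulKg;
  split=> //; apply: first_letter1.
have [nKxs] := IHw _ rw Kw; rewrite -mulgA => Kxw; split=> // Kx.
have hK := walls_halfspaces Kw.
have : (~` K) (x * (gen s * val_of w)); last by apply.
rewrite (halfspace_edge (halfspacesC hK) (y := x) (s := s)) //.
by rewrite translateE mulKg.
Qed.

Lemma uniq_walls x w : reduced w -> uniq (walls x w).
Proof.
elim: w x => //= s w IHw x [nsw rw]; rewrite IHw // andbT.
apply/negP => /(walls_separate rw)[+ _]; rewrite translateE mulKg.
by rewrite -[gen s]mulg1 => /first_letter_genM/contrapT/first_letter1.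
Qed.

(** A reduced word of length [n] crosses [n] distinct halfspaces, so the number
    of separating halfspaces bounds the word length. *)
Lemma raag_wallspace : wallspace halfspaces.
Proof.
split; [exact: halfspaces_translate|exact: halfspacesC| |].
  move=> g; have [w _ ->] := exists_reduced g; exists (walls 1 w) => K hK K1 Kw.
  by apply: walls_complete => //; rewrite mul1g.
move=> C; have [B HB] : exists B : seq (raag e),
    forall w, (size w <= C)%N -> val_of w \in B.
  elim: C => [|C [B HB]].
    by exists [:: val_of [::]] => -[] //; rewrite inE.
  exists (val_of [::] :: [seq gen l * g | l <- enum {: V * bool}, g <- B]).
  move=> [|l w] sw; rewrite inE ?eqxx //; apply/orP; right.
  rewrite word_val_cons; apply: allpairs_f; last exact: HB.
  by rewrite mem_enum.
exists B => g [S sS HS]; have [w rw gw] := exists_reduced g; rewrite gw.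
apply: HB; apply: leq_trans sS; rewrite -(size_walls 1).
apply: uniq_leq_size => [|K Kw]; first exact: uniq_walls.
have [K1] := walls_separate rw Kw; rewrite mul1g -gw => Kg.
exact: HS (walls_halfspaces Kw) K1 Kg.
Qed.

(** * Crossing halfspaces and commuting conjugates *)

(** The first letter [r] of [w] is removed by induction.  If it commutes with
    [s], it fixes [first_letter s].  If not, [first_letter r] is equal to
    [first_letter s], and induction applies to the inverse letter, or disjoint
    from it.  In the second case, if [K] also crosses [first_letter r], then by
    induction [r] stabilizes [K] and can be deleted from [w]; and if [K] does
    not cross [first_letter r], then [K] cannot cross [first_letter s], since
    the wall of [K] lies on the far side of the wall of [first_letter r]. *)
Lemma cross_first_letter w s t : reduced w ->
    let K := translate (val_of w) (first_letter t) in
    cross (first_letter s) K -> e s.1 t.1 /\ translate (gen s) K = K.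
Proof.
elim: w s => [|r w IHw] s rw /=.
  rewrite word_val_nil translate1 => -[[x [sx tx]] [y [sy ty]] _ _].
  have st : e s.1 t.1.
    apply: (first_letter_commute sx tx) => st.
    by apply: ty; rewrite -st.
  by split=> //; apply: translate_adj.
case: rw => nrw rw; rewrite word_val_cons translateM.
set K := translate (val_of w) _ => sK.
have [adj|far] := boolP (e r.1 s.1).
  have [|st sKK] := IHw s rw.
    move/cross_translateV: sK; rewrite -[gen r]invgK -letter_valV invgK.
    by rewrite (@translate_adj s (inv_letter r)).
  by split=> //; rewrite -translateM -(gen_commute adj) translateM sKK.
have rK : cross (first_letter r) (translate (gen r) K) ->
    e r.1 t.1 /\ translate (gen r) K = K.
  move=> /cross_translateV/crossCl.
  rewrite -translateC first_letterC -translateM mulVg translate1.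
  move/(IHw _ rw) => [rt]; rewrite letter_valV -/K => rK; split=> //.
  by rewrite -[in LHS]rK -translateM mulgV translate1.
have [rs|rs] := pselect (r = s).
  rewrite -rs in sK *; have [rt rKK] := rK sK.
  by split; rewrite ?rKK.
have disj x : first_letter r x -> first_letter s x -> False.
  by move=> rx sx; case/negP: far; apply: first_letter_commute rx sx rs.
have [/rK[_ rKK]|/not_crossP nrK] :=
    pselect (cross (first_letter r) (translate (gen r) K)).
  by rewrite rKK in sK *; apply: IHw.
case: sK => [[x [sx Kx]] [y [sy Ky]] _ _].
have nKw : ~ K (val_of w) by rewrite /K translateE mulVg; apply: first_letter1.
have Kwt : K (val_of w * gen t).
  rewrite /K translateE mulKg -[gen t]mulg1.
  exact/first_letter_genM/first_letter1.
have rE z : first_letter r (gen r * z) <-> ~ first_letter (inv_letter r) z.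
  exact: first_letter_genM.
case: nrK => [sub|sub|sub|cov].
- (* [K] is contained in [first_letter (inv_letter r)], and both are entered
     along the edge from [val_of w] labelled [t], so they are equal. *)
  have Kr z : K z -> first_letter (inv_letter r) z.
    move=> Kz; apply: contrapT => /rE/sub; apply.
    by rewrite translateE mulKg.
  have hr : halfspaces (first_letter (inv_letter r)).
    by exists 1, (inv_letter r); rewrite translate1.
  have rKE := halfspace_edge hr nrw (Kr _ Kwt).
  case: (disj y) => //; rewrite -[y](mulVKg (gen r)); apply/rE.
  by move: Ky; rewrite /setC /= translateE /K -rKE.
- case: nrw; apply: contrapT => /rE/sub; rewrite translateE mulKg.
  exact: nKw.
- by case: (disj x) => //; apply: sub.
- case: (disj y) => //; apply: contrapT => /cov; exact: Ky.
Qed.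

(** [y] fixes the halfspace, so it maps the edge from [1] to [gen t] to an edge
    that also enters the halfspace; such edges are based at elements commuting
    with [t]. *)
Lemma stabilizer_commute y t :
  translate y (first_letter t) = first_letter t -> commute y (gen t).
Proof.
move=> yt; have ny : ~ first_letter t y.
  by rewrite -yt translateE mulVg; apply: first_letter1.
have [] // := edge_crossing (s := t) ny; rewrite -yt translateK -[gen t]mulg1.
exact/first_letter_genM/first_letter1.
Qed.

(** The conjugate of [s.1] by [g^-1] stabilizes the second halfspace, hence
    commutes with the conjugate attached to it. *)
Lemma cross_halfspaces g h s t :
    cross (translate g (first_letter s)) (translate h (first_letter t)) ->
  e s.1 t.1 /\ commute (raag_gen e s.1 ^ g^-1) (raag_gen e t.1 ^ h^-1).
Proof.
move/(cross_translate g^-1); rewrite -!translateM mulVg translate1.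
have [w rw ghw] := exists_reduced (g^-1 * h); rewrite ghw.
move/(cross_first_letter rw) => [st]; rewrite -ghw -translateM => sgh.
split=> //.
have : commute (gen s ^ (g^-1 * h)) (gen t).
  apply: stabilizer_commute; rewrite conjgE translateM sgh.
  by rewrite -translateM mulVg translate1.
move=> c; have {c} : commute ((gen s ^ (g^-1 * h)) ^ h^-1) (gen t ^ h^-1).
  by rewrite /commute -!conjMg c.
rewrite -conjgM mulgK.
have sign l x :
    gen l ^ x = if l.2 then raag_gen e l.1 ^ x else (raag_gen e l.1 ^ x)^-1.
  by rewrite /letter_val; case: l.2 => //; rewrite conjVg.
rewrite !sign; case: s.2; case: t.2 => //.
- by move/commuteV; rewrite invgK.
- by move=> /commute_sym/commuteV/commute_sym; rewrite invgK.
- move=> /commuteV/commute_sym/commuteV/commute_sym; rewrite !invgK; exact.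
Qed.

(** * Every nontrivial element skewers a halfspace *)

(** The path spelled by an arbitrary word ending in [first_letter s] enters
    this halfspace along an edge with label [s] based at an element that
    commutes with [s]; this occurrence of [s] can be moved to the front. *)
Lemma shorten w s : first_letter s (val_of w) ->
  exists2 u, (size u < size w)%N & val_of w = gen s * val_of u.
Proof.
suff shorten_from v : ~ first_letter s (val_of v) ->
    first_letter s (val_of v * val_of w) ->
    exists2 u, (size u < size v + size w)%N &
      val_of v * val_of w = gen s * val_of u.
  move=> sw; have [||u] := shorten_from [::].
  - exact: first_letter_nil.
  - by rewrite word_val_nil mul1g.
  - by rewrite word_val_nil mul1g add0n; exists u.
elim: w v => [|r w IHw] v nv; first by rewrite word_val_nil mulg1 => /nv.
rewrite word_val_cons mulgA => svw.
have [svr|nsvr] := pselect (first_letter s (val_of v * gen r)).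
  have [-> vs _] := edge_crossing nv svr.
  exists (v ++ w); first by rewrite size_cat /= addnS.
  by rewrite vs word_val_cat mulgA.
have vrE : val_of v * gen r = val_of (rcons v r).
  by rewrite -cats1 word_val_cat word_val_cons word_val_nil mulg1.
rewrite vrE in svw nsvr *; have [u su ->] := IHw _ nsvr svw.
by exists u => //; rewrite size_rcons /= addSnnS in su.
Qed.

(** Take a shortest word [s :: u] among those representing a conjugate of the
    element, and let [mu] be its value.  By minimality [mu] is in [first_letter
    s] and its inverse is not, that is, [1] is not in [mu * first_letter s].
    These two halfspaces do not cross since they have the same label, and the
    position of the points [1], [mu] and [mu * gen s] shows how they are
    nested. *)
Lemma exists_skewered (lambda : raag e) : lambda <> 1 ->
  exists g s, let K := translate g (first_letter s) in
    translate lambda K `<=` K /\ ~ (K `<=` translate lambda K).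
Proof.
move=> lambda1.
have exn : exists n, `[< exists w g, size w = n /\ val_of w = lambda ^ g >].
  have [w _ lw] := exists_reduced lambda; exists (size w); apply/asboolP.
  by exists w, 1; rewrite conjg1.
have [n /asboolP[w [g [wn wl]]] minn] := ex_minnP exn.
have {}minn u h : val_of u = lambda ^ h -> (size w <= size u)%N.
  by move=> uh; rewrite wn; apply: minn; apply/asboolP; exists u, h.
have w1 : val_of w <> 1.
  by rewrite wl => /eqP; rewrite conjg_eq1 => /eqP.
case: w => [|s u] in wl w1 minn {wn} *; first by rewrite word_val_nil in w1.
set mu := val_of (s :: u) in wl w1 *.
have muE : mu = gen s * val_of u by rewrite /mu word_val_cons.
have smu : first_letter s mu.
  rewrite muE; apply/first_letter_genM => /shorten[v vu uv].
  have /minn : val_of v = lambda ^ g by rewrite -wl muE uv letter_valV mulVKg.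
  by rewrite leqNgt /= ltnS ltnW.
have nsmuV : ~ first_letter s mu^-1.
  have : ~ first_letter s (val_of u)^-1.
    rewrite -word_valV => /shorten[v].
    rewrite /inv_word size_rev size_map => vu.
    rewrite -/(inv_word u) word_valV => uv.
    have /minn : val_of (inv_word v) = lambda ^ (g * gen s).
      rewrite conjgM -wl muE conjgE -mulgA mulKg word_valV.
      by apply: invg_inj; rewrite invgK invgM uv mulKg.
    by rewrite leqNgt /inv_word size_rev size_map /= ltnS ltnW.
  rewrite muE invgM -letter_valV => nsu ssu.
  have [ss _ _] := edge_crossing nsu ssu.
  (* A letter is not its own inverse. *)
  by case: (s) ss => ? [].
set H := first_letter s; set K := translate mu H.
have Kmu : ~ K mu by rewrite /K translateE mulVg; apply: first_letter1.
have K1 : ~ K 1 by rewrite /K translateE mulg1.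
have hH : halfspaces H by exists 1, s; rewrite translate1.
have Kmus : K (mu * gen s).
  rewrite /K translateK -[gen s]mulg1; exact/first_letter_genM/first_letter1.
have Hmus : H (mu * gen s).
  apply: contrapT => nH.
  have HK : ~` H = K.
    by apply: halfspace_edge (halfspacesC hH) _ nH => /(_ smu).
  by apply: K1; rewrite -HK; apply: first_letter1.
have muH : K `<=` H.
  have /not_crossP : ~ cross H K.
    rewrite -[H]translate1 => /cross_halfspaces[].
    by rewrite e_irr.
  case=> [sub|sub|//|cov].
  - by case: (sub _ Hmus).
  - by case: Kmu; apply: sub.
  - by case: K1; apply: cov; apply: first_letter1.
have KE : translate lambda (translate g H) = translate g K.
  by rewrite /K wl conjgE -!translateM mulgA mulgA mulgV mul1g.
exists g, s; rewrite /= -/H KE; split; first exact: translate_sub.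
by move/translate_subE/(_ _ smu).
Qed.
End RightAngledArtin.

(** * The extension graph *)

Section Walks.
Variables (T : eqType) (e : rel T).

Lemma walk_refl x : is_walk_length e x x 0.
Proof. by exists [::]. Qed.

Lemma walk_edge x y : e x y -> is_walk_length e x y 1.
Proof. by move=> xy; exists [:: y]; rewrite /= xy. Qed.

Lemma walk_cat x y z m n : is_walk_length e x y m -> is_walk_length e y z n ->
  is_walk_length e x z (m + n).
Proof.
move=> [p [xp py pm]] [q [yq qz qn]]; exists (p ++ q).
by rewrite cat_path xp py yq last_cat py qz size_cat pm qn.
Qed.

Lemma walk_rev x y n : symmetric e ->
  is_walk_length e x y n -> is_walk_length e y x n.
Proof.
move=> e_sym [p [xp py pn]]; exists (rev (belast x p)); split.
- rewrite -py rev_path; apply: sub_path xp => u v; by rewrite e_sym.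
- by case: p xp py pn => //= z p _ _ _; rewrite rev_cons last_rcons.
- by rewrite size_rev size_belast.
Qed.

Lemma walk_map (f : T -> T) x y n : (forall u v, e u v -> e (f u) (f v)) ->
  is_walk_length e x y n -> is_walk_length e (f x) (f y) n.
Proof.
move=> ef [p [xp py pn]]; exists (map f p); split.
- by rewrite path_map; apply: sub_path xp.
- by rewrite last_map py.
- by rewrite size_map.
Qed.

Lemma graph_dist_le x y n : is_walk_length e x y n -> (graph_dist e x y <= n)%N.
Proof.
move=> xyn; rewrite /graph_dist; case: pselect => // h.
by case: ex_minnP => m _; apply; apply/asboolP.
Qed.

End Walks.

Section ExtensionGraph.
Import Order.TTheory GRing.Theory Num.Theory.
Variables (V : finType) (e : rel V).
Hypotheses (e_sym : symmetric e) (e_irr : irreflexive e).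
Hypothesis e_conn : forall u v : V, connect e u v.
Local Notation ext := (@ext_vertices V e).
Local Notation walk := (is_walk_length (@ext_adj V e)).

Lemma ext_adj_sym : symmetric (@ext_adj V e).
Proof. by move=> x y; rewrite /ext_adj eq_sym [X in _ && X]eq_sym. Qed.

Lemma ext_act_adj g x y :
  @ext_adj V e x y -> ext_adj (ext_act x g) (ext_act y g).
Proof.
move=> /andP[xy /eqP c]; apply/andP; split.
  by apply: contra xy => /eqP/(congr1 val)/= /conjg_inj/val_inj ->.
by rewrite /= -!conjMg c.
Qed.

Lemma ext_actM x g h : @ext_act V e x (g * h) = ext_act (ext_act x g) h.
Proof. by apply: val_inj; rewrite /= conjgM. Qed.

Lemma ext_act1 x : @ext_act V e x 1 = x.
Proof. by apply: val_inj; rewrite /= conjg1. Qed.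

Lemma walk_act g x y n : walk x y n -> walk (ext_act x g) (ext_act y g) n.
Proof.
by apply: (walk_map (f := fun z => ext_act z g)); apply: ext_act_adj.
Qed.

Lemma walk_commute (x y : ext) : commute (val x) (val y) ->
  exists2 n, (n <= 1)%N & walk x y n.
Proof.
move=> xy; have [->|neq] := eqVneq x y.
  by exists 0%N => //; apply: walk_refl.
by exists 1%N => //; apply: walk_edge; rewrite /ext_adj neq xy eqxx.
Qed.

Lemma root_subproof (v : V) g : raag_gen e v ^ g \in ext.
Proof. by apply/mem_set; exists v, g. Qed.

Definition ext_root (v : V) (g : raag e) : ext := SigSub (root_subproof v g).

Lemma ext_rootM v g h : ext_root v (g * h) = ext_act (ext_root v g) h.
Proof. by apply: val_inj; rewrite /= conjgM. Qed.

Definition linked (x y : ext) := exists n, walk x y n.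

Lemma linked_trans x y z : linked x y -> linked y z -> linked x z.
Proof. by move=> [m xy] [n yz]; exists (m + n)%N; apply: walk_cat yz. Qed.

Lemma linked_sym x y : linked x y -> linked y x.
Proof. by move=> [m xy]; exists m; apply: walk_rev xy; apply: ext_adj_sym. Qed.

Lemma linked_act g x y : linked x y -> linked (ext_act x g) (ext_act y g).
Proof. by move=> [m xy]; exists m; apply: walk_act. Qed.

Lemma linked_commute (x y : ext) : commute (val x) (val y) -> linked x y.
Proof. by move=> /walk_commute[n _ xy]; exists n. Qed.

Lemma linked_gens u v : linked (ext_root u 1) (ext_root v 1).
Proof.
have /connectP[p up ->] := e_conn u v.
elim: p u up => [|w p IHp] u /=; first by exists 0%N; apply: walk_refl.
move=> /andP[uw /IHp]; apply: linked_trans; apply: linked_commute => /=.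
by rewrite !conjg1; apply: (gen_commute (l := (u, true)) (m := (w, true))).
Qed.

(** A path in the graph from [u] to the vertex of a letter [l], conjugated by
    [l], joins the conjugate of [u] by [l] to that vertex, which [l] fixes; in
    this way the letters of [g] are removed one by one. *)
Lemma linked_roots u v g : linked (ext_root u g) (ext_root v 1).
Proof.
have [w ->] := raag_classP g; rewrite -word_valE.
elim: w u => [|l w IHw] u; first by rewrite word_val_nil; apply: linked_gens.
apply: linked_trans (IHw l.1).
rewrite word_val_cons ext_rootM -[X in ext_root l.1 X]mul1g ext_rootM.
apply: linked_act; rewrite -[letter_val _ _]mul1g ext_rootM.
apply: linked_trans (linked_act _ (linked_gens u l.1)) _.
apply: linked_commute; rewrite /= conjg1.
suff -> : raag_gen e l.1 ^ letter_val (raag_gen e) l = raag_gen e l.1 by [].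
by rewrite /letter_val; case: l.2; rewrite conjgE ?mulKg // invgK mulgV mulg1.
Qed.

Lemma linked_all x y : linked x y.
Proof.
have root (z : ext) : exists v g, z = ext_root v g.
  case: z => z zP; have [v [g zE]] := set_mem zP.
  by exists v, g; apply: val_inj.
have [u [g ->]] := root x; have [v [h ->]] := root y.
by apply: linked_trans (linked_roots u u g) _; apply/linked_sym/linked_roots.
Qed.

(** If all powers moved [z] by at most [C], they would move every vertex by a
    bounded amount, and the translation length would be zero. *)
Lemma loxodromic_unbounded (R : realType) (g : raag e) : loxodromic R g ->
  forall (z : ext) C, exists2 n, (0 < n)%N &
    forall m, walk z (ext_act z (g ^+ n)) m -> (C < m)%N.
Proof.
move=> [x [L [L0 cvL]]] z C; apply: contrapT => bounded.
have {}bounded n : exists2 m, (m <= C)%N & walk z (ext_act z (g ^+ n)) m.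
  case: n => [|n]; first by exists 0%N; rewrite ?ext_act1 //; apply: walk_refl.
  apply: contrapT => nwalk; apply: bounded; exists n.+1 => // m zm.
  by rewrite ltnNge; apply/negP => mC; apply: nwalk; exists m.
have [k xz] := linked_all x z.
have dist_le n :
    (graph_dist (@ext_adj V e) x (ext_act x (g ^+ n)) <= k + C + k)%N.
  have [m mC zm] := bounded n.
  apply: (@leq_trans (k + m + k)); last by rewrite leq_add2r leq_add2l.
  apply: graph_dist_le; apply: walk_cat; first exact: walk_cat xz zm.
  by apply: walk_rev; [exact: ext_adj_sym|exact: walk_act].
pose D : R := ((k + C + k)%:R)%R.
have /cvgr_gt/(_ (L / 2)%R) := cvL.
rewrite ltr_pdivrMr // ltr_pMr // ltr1n => /(_ isT) near_gt.
near \oo => n.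
have n0 : (0 < n%:R :> R)%R by near: n; apply: nbhs_infty_gtr.
have : (L / 2 < n%:R^-1 * D)%R.
  apply: (@lt_le_trans _ _ (n%:R^-1 *
    (graph_dist (@ext_adj V e) x (ext_act x (g ^+ n)))%:R)%R).
    by near: n.
  by rewrite ler_pM2l ?invr_gt0 // ler_nat.
rewrite [X in (_ < X)%R]mulrC ltr_pdivlMr // -ltr_pdivlMl ?divr_gt0 //.
apply/negP; rewrite -leNgt ltW //; near: n; exact: nbhs_infty_gtr.
Unshelve. all: by end_near.
Qed.

(** A halfspace that crosses both [K] and a translate of [K] gives a vertex of
    the extension graph that commutes with both of the vertices attached to
    them; so any power that moves the vertex of [K] by more than two will do. *)
Lemma loxodromic_separated (R : realType) (g : raag e) (K : set (raag e)) :
    loxodromic R g -> halfspaces K ->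
  exists2 p, (0 < p)%N & forall J, halfspaces J -> cross J K ->
    cross J (translate (g ^+ p) K) -> False.
Proof.
move=> lox [h [s KE]].
have [p p0 far] := loxodromic_unbounded lox (ext_root s.1 h^-1) 2.
exists p => // J [j [t ->]]; rewrite KE -translateM.
move=> /(cross_halfspaces e_sym e_irr)[_ c1].
move=> /(cross_halfspaces e_sym e_irr)[_ c2].
pose y := ext_root t.1 j^-1; pose z := ext_root s.1 h^-1.
have [m m1 zy] : exists2 m, (m <= 1)%N & walk z y m.
  exact/walk_commute/commute_sym.
have [n n1 yz] : exists2 n, (n <= 1)%N & walk y (ext_act z (g ^- p)) n.
  by apply: walk_commute; rewrite /= -conjgM -invgM.
have {yz} : walk (ext_act y (g ^+ p)) z n.
  by rewrite -[z]ext_act1 -(mulVg (g ^+ p)) ext_actM; apply: walk_act.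
move=> /(walk_rev ext_adj_sym) zy'; have {zy} := walk_act (g ^+ p) zy.
move/(walk_rev ext_adj_sym)/(walk_cat zy')/far.
by rewrite ltnNge (leq_add n1 m1).
Qed.

Lemma loxodromic_neq1 (R : realType) (g : raag e) : loxodromic R g -> g <> 1.
Proof.
move=> lox g1; have [x _] := lox.
have [n _ /(_ 0)] := loxodromic_unbounded lox x 0.
by rewrite g1 expg1n ext_act1 => /(_ (walk_refl _ _)).
Qed.

Lemma loxodromic_axial (R : realType) (g : raag e) : loxodromic R g ->
  exists K p, [/\ translate g K `<=` K, (0 < p)%N &
    axial (@halfspaces V e) (g ^+ p) K].
Proof.
move=> lox; have g1 := loxodromic_neq1 lox.
have [h [s /= [gK nKg]]] := exists_skewered e_sym e_irr g1.
set K := translate h _ in gK nKg.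
have hK : halfspaces K by exists h, s.
have [p p0 sepK] := loxodromic_separated lox hK.
exists K, p; split=> //; split=> //.
- elim: (p) => [|n IHn]; first by rewrite expg0 translate1.
  by rewrite expgS translateM => x /(translate_sub IHn)/gK.
- case: p p0 {sepK} => // n _ sub; apply: nKg => x /sub.
  rewrite expgS translateM; apply: translate_sub => {x} x.
  elim: n {sub} x => [|n IHn] x; first by rewrite expg0 translate1.
  by rewrite expgS translateM => /(translate_sub IHn)/gK.
Qed.

End ExtensionGraph.

Theorem theorem47 (R : realType) (V : finType) (e : rel V)
    (e_sym : symmetric e) (e_irr : irreflexive e)
    (e_conn : forall u v : V, connect e u v)
    (k : nat) (lambda : 'I_k -> raag e)
    (lambda_lox : forall i : 'I_k, loxodromic R (lambda i))
    (lambda_indep : forall i j : 'I_k, i <> j ->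
       ~ share_nonzero_power (lambda i) (lambda j)) :
  exists N0 : nat, forall N : nat, (N0 <= N)%N ->
    isomorphic_to_subgroup (free_group k)
      (generated (range (fun i : 'I_k => (lambda i ^+ N)%g))).
Proof.
have /choice[H /choice[p Hp]] i :=
  loxodromic_axial e_sym e_irr e_conn (lambda_lox i).
apply: (powers_free (hs := @halfspaces V e) (H := H) (p := p)) lambda_indep.
- exact: raag_wallspace.
- by move=> i; have [] := Hp i.
- by move=> i; have [] := Hp i.
- by move=> i; have [] := Hp i.
Qed.
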